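(* Let $\alpha\in(0,1)$. There exists $C(\alpha)>0$ such that for every $u\in L^\infty([0,1],C^\alpha(\mathbb T^2))$, all $\kappa\in(0,1)$, $x\in\mathbb T^2$ and $t\in[0,1]$, if $X^\kappa_t$ is a solution to $$dX^\kappa_t=u(t,X^\kappa_t)\,dt+\sqrt{2\kappa}\,dw_t,\qquad X^\kappa_0=x,$$ with $w_t$ a standard Brownian motion in $\mathbb R^2$, then $$\mathrm{Var}(X^\kappa_t)\le C\Big(\kappa t+\big(\|u\|_{L^\infty([0,1],C^\alpha(\mathbb T^2))}\,t\big)^{\frac2{1-\alpha}}\Big).$$
   Context: $\mathbb T^2$ is $[0,\sqrt2]\times[0,1]$ with periodic boundary. For a $\mathbb T^2$-valued random variable $X$ with law $\mu$, $\mathrm{Var}(X):=\inf_{a\in\mathbb T^2}\int_{\mathbb T^2}|x-a|^2\,d\mu(x)$, where $|x-y|$ is the distance in $\mathbb T^2$. The field $u$ takes values in $\mathbb R^2$. *)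

(* Defs.v *)
From HB Require Import structures.
From mathcomp Require Import all_boot all_order all_algebra generic_quotient.
From mathcomp Require Import all_classical all_reals all_analysis.
From mathcomp Require Import ess_sup_inf.

Set Implicit Arguments.
Unset Strict Implicit.
Unset Printing Implicit Defensive.

Import Order.TTheory GRing.Theory Num.Theory.
Import numFieldNormedType.Exports.

Local Open Scope classical_set_scope.
Local Open Scope ring_scope.
Local Open Scope quotient_scope.

(* The norm of the library on [R * R] is the sup norm; the Euclidean one is
   needed here. *)
Definition enorm (R : realType) (v : R * R) : R :=
  Num.sqrt (v.1 ^+ 2 + v.2 ^+ 2).

Section torus.
Variable R : realType.

(* Congruence modulo the lattice sqrt 2 Z x Z. *)
Definition lattice_rel : rel (R * R) := fun p q =>
  ((p.1 - q.1) / Num.sqrt 2 \is a Num.int) && (p.2 - q.2 \is a Num.int).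

Lemma lattice_rel_equiv : equiv_class_of lattice_rel.
Proof.
split=> [p|p q|q p r].
- by rewrite /lattice_rel !subrr mul0r rpred0.
- rewrite /lattice_rel -[p.1 - _]opprB -[p.2 - _]opprB mulNr.
  by rewrite !rpredN.
- move=> /andP[pq1 pq2] /andP[qr1 qr2]; apply/andP; split.
    by rewrite -(subrKA q.1) mulrDl rpredD.
  by rewrite -(subrKA q.2) rpredD.
Qed.

Canonical lattice_equiv := EquivRelPack lattice_rel_equiv.
Canonical lattice_encModRel := defaultEncModRel lattice_rel.

(* R^2 / (sqrt 2 Z x Z), with its quotient topology and Borel sigma-algebra. *)
Definition torus_quot := {eq_quot lattice_rel}.

Definition torus := quotient_topology torus_quot.

HB.instance Definition _ := Topological.copy torus (quotient_topology torus_quot).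
HB.instance Definition _ := Quotient.copy torus (quotient_topology torus_quot).
HB.instance Definition _ := isPointed.Build torus (\pi_torus (0, 0)).

HB.instance Definition _ :=
  Measurable.copy torus (g_sigma_algebraType (@open torus)).

(* Action of R^2 on the torus by translations. *)
Definition tadd (x : torus) (v : R * R) : torus := \pi_torus (repr x + v).

Lemma tadd_pi (p v : R * R) : tadd (\pi_torus p) v = \pi_torus (p + v).
Proof.
have latticeD a b : lattice_rel a b -> lattice_rel (a + v) (b + v).
  case: a b v => [a1 a2] [b1 b2] [v1 v2]; rewrite /lattice_rel /= => h.
  by rewrite !opprD !(addrACA _ v1) !(addrACA _ v2) !subrr !addr0.
by apply/eqquotP/latticeD/eqquotP; exact: (@reprK _ torus).
Qed.

(* Flat distance: the smallest Euclidean distance between two lifts. *)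
Definition tdist (x y : torus) : R :=
  inf [set enorm (p.1 - p.2) | p in
       [set p : (R * R) * (R * R) | \pi_torus p.1 = x /\ \pi_torus p.2 = y]].

End torus.

(* The full, non-homogeneous C^alpha norm; it is +oo outside C^alpha. *)
Definition holder_norm (R : realType) (alpha : R) (f : torus R -> R * R) :
    \bar R :=
  (ereal_sup [set (enorm (f x))%:E | x in [set: torus R]] +
   ereal_sup [set (enorm (f p.1 - f p.2) / tdist p.1 p.2 `^ alpha)%:E
             | p in [set p : torus R * torus R | p.1 != p.2]])%E.

Definition Linf_holder_norm (R : realType) (alpha : R)
    (u : R -> torus R -> R * R) : \bar R :=
  ess_sup lebesgue_measure
    ((fun t => holder_norm alpha (u t)) \_ `[0%R, 1%R]).

(* Measurability in time is only asked pointwise in space; this is implied by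
   strong measurability in the (non-separable) space C^alpha.  Elements of
   L^oo are given by representatives, so [u t] may fail to be in C^alpha for
   a negligible set of times. *)
Definition Linf_holder (R : realType) (alpha : R) (u : R -> torus R -> R * R) :
    Prop :=
  (forall x, measurable_fun (`[0, 1] : set R) (fun t => u t x)) /\
  (Linf_holder_norm alpha u < +oo)%E.

Section probability.
Context d (Om : measurableType d) (R : realType) (P : probability Om R).

Record is_filtration (F : R -> set (set Om)) : Prop := {
  filtration_sigma_algebra : forall t : R, 0 <= t -> sigma_algebra setT (F t) ;
  filtration_measurable : forall t : R, 0 <= t -> F t `<=` measurable ;
  filtration_mono : forall s t : R, 0 <= s -> s <= t -> F s `<=` F t }.

Definition adapted d' (T : measurableType d') (F : R -> set (set Om))
    (I : set R) (Y : R -> Om -> T) : Prop :=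
  forall t, I t -> forall B, measurable B -> F t (Y t @^-1` B).

(* Standard two-dimensional F-Brownian motion on [0, +oo[.  The second
   parameter of [normal_prob] is the standard deviation. *)
Record is_brownian_motion (F : R -> set (set Om))
    (w : R -> {RV P >-> (R * R)%type}) : Prop := {
  brownian_adapted : adapted F `[0, +oo[ w ;
  brownian_start : {ae P, forall om, w 0 om = 0} ;
  brownian_increment : forall (s t : R), 0 <= s -> s < t ->
    forall B : set (R * R), measurable B ->
    P [set om | B (w t om - w s om)] =
    (normal_prob 0 (Num.sqrt (t - s)) \x normal_prob 0 (Num.sqrt (t - s)))%E B ;
  brownian_independent : forall (s t : R), 0 <= s -> s < t ->
    forall (A : set Om) (B : set (R * R)), F s A -> measurable B ->
    P (A `&` [set om | B (w t om - w s om)]) =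
    (P A * P [set om | B (w t om - w s om)%R])%E ;
  brownian_continuous :
    {ae P, forall om, {within `[0, +oo[, continuous (fun t => w t om)}} }.

(* dX = u(t, X) dt + sqrt(2 kappa) dw, X_0 = x, on [0, 1].  The noise being
   additive, the stochastic integral is sqrt(2 kappa) w_t; the displacement,
   a vector of R^2, acts on the starting point by translation. *)
Record is_sde_solution (u : R -> torus R -> R * R) (kappa : R) (x : torus R)
    (F : R -> set (set Om)) (w : R -> {RV P >-> (R * R)%type})
    (X : R -> {RV P >-> torus R}) : Prop := {
  sde_adapted : adapted F `[0, 1] X ;
  sde_continuous :
    {ae P, forall om, {within `[0, 1], continuous (fun t => X t om)}} ;
  sde_integrable : {ae P, forall om,
    lebesgue_measure.-integrable `[0, 1] (fun s => (u s (X s om)).1%:E) /\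
    lebesgue_measure.-integrable `[0, 1] (fun s => (u s (X s om)).2%:E)} ;
  sde_equation : {ae P, forall om, forall t : R, 0 <= t <= 1 ->
    X t om = tadd x
      (\int[lebesgue_measure]_(s in `[0, t]) (u s (X s om)).1 +
         Num.sqrt (2 * kappa) * (w t om).1,
       \int[lebesgue_measure]_(s in `[0, t]) (u s (X s om)).2 +
         Num.sqrt (2 * kappa) * (w t om).2)} }.

Definition torus_variance (X : {RV P >-> torus R}) : \bar R :=
  ereal_inf [set \int[distribution P X]_y ((tdist y a) ^+ 2)%:E
            | a in [set: torus R]]%E.

End probability.

(* Main.v *)
Require Import Defs.
From HB Require Import structures.
From mathcomp Require Import all_boot all_order all_algebra generic_quotient.
From mathcomp Require Import all_classical all_reals all_analysis.
From mathcomp Require Import ess_sup_inf measurable_realfun.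
From mathcomp Require Import ring lra zify.

(** The solution is compared with itself for another outcome of the noise. Fix
    an outcome [om'] and use the point [X t om'] as the centre [a] in the
    definition of the variance. No solution of the equation without noise, hence
    no existence theorem, is needed.

    For almost all [om] and [om'], the difference of the two trajectories,
    lifted to the plane, is [D + N], where [D] is the integral of the difference
    of the velocities and [N = sqrt (2 kappa) (w om - w om')]. With [M] the norm
    of [u], at almost every time the modulus of the integrand is at most
    [M (|D| + |N|) ^ alpha], where [|.|] is the [l ^ 1] norm. A power
    [r ^ alpha] is at most [c ^ alpha + c ^ (alpha - 1) r] for every level
    [c > 0]. For [c = (4 M t) ^ (1 / (1 - alpha))] the part that is linear in
    [D] has coefficient 1 / 2 and is absorbed, which leaves
    [|D t| <= c + (average of |N| over [0, t])]: this is [holder_drift_bound].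
    As the noise enters only through its time average and not through its
    supremum, no maximal inequality is needed.

    Squaring and applying Jensen's inequality ([trajectories_close]) bounds
    [tdist (X t om) (X t om') ^ 2] by [3 c ^ 2] plus [24 kappa (G om + G om')],
    where [G] is the sum of the time average and of the final value of the
    squared Euclidean norm of [w]. The expectation of [G] is at most [32 t], by
    the second moment of the Brownian increments and Tonelli's theorem
    ([expectation_mean_cost]). Integrating in [om] bounds the variance for almost
    every [om'], and integrating in [om'] gives the result. *)

Import Order.TTheory GRing.Theory Num.Theory.
Import numFieldNormedType.Exports.

Local Open Scope classical_set_scope.
Local Open Scope ring_scope.

(** * Distance on the torus *)

Section torus_distance.
Local Open Scope quotient_scope.
Context {R : realType}.
Implicit Types (x y a : torus R) (v w p q : R * R).

Lemma enorm_ge0 v : 0 <= enorm v.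
Proof. exact: sqrtr_ge0. Qed.

Lemma normr_fst_le_enorm v : `|v.1| <= enorm v.
Proof. by rewrite -sqrtr_sqr ler_wsqrtr// lerDl sqr_ge0. Qed.

Lemma normr_snd_le_enorm v : `|v.2| <= enorm v.
Proof. by rewrite -sqrtr_sqr ler_wsqrtr// lerDr sqr_ge0. Qed.

Lemma enorm_le_l1 v : enorm v <= `|v.1| + `|v.2|.
Proof.
rewrite -[leRHS]ger0_norm ?addr_ge0// -sqrtr_sqr ler_wsqrtr//.
rewrite sqrrD !real_normK ?num_real//.
by have := mulr_ge0 (normr_ge0 v.1) (normr_ge0 v.2); lra.
Qed.

Lemma pi_torusE p q :
  (\pi_(torus R) p = \pi_(torus R) q) <-> lattice_rel p q.
Proof. by split => [/eqquotP|h]; last apply/eqquotP. Qed.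

Lemma tdist_ge0 x y : 0 <= tdist x y.
Proof.
by apply: lb_le_inf; [exists (enorm (repr x - repr y)), (repr x, repr y) => //=;
  rewrite !reprK | move=> _ [p _ <-]; exact: enorm_ge0].
Qed.

Lemma tdist_le p q :
  tdist (\pi_(torus R) p) (\pi_(torus R) q) <= enorm (p - q).
Proof.
apply: ge_inf; last by exists (p, q).
by exists 0 => _ [? _ <-]; exact: enorm_ge0.
Qed.

Lemma tdist_tadd x v w : tdist (tadd x v) (tadd x w) <= enorm (v - w).
Proof.
rewrite /tadd (le_trans (tdist_le _ _))//.
by rewrite opprD addrACA subrr add0r.
Qed.

(** A non-integer stays at a positive distance from the integers. *)
Lemma non_int_dist (r : R) : r \isn't a Num.int ->
  exists2 e, 0 < e & forall k, k \is a Num.int -> e <= `|r - k|.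
Proof.
move=> rN; have fr := floor_itv r.
set f : R := (Num.floor r)%:~R.
have fl : f < r.
  rewrite lt_neqAle; case/andP: fr => -> _; rewrite andbT.
  by apply: contra rN => /eqP <-; rewrite intr_int.
have ru : r < f + 1 by case/andP: fr => _; rewrite intrD.
exists (Num.min (r - f) (f + 1 - r)).
  by rewrite lt_min !subr_gt0 fl.
move=> k /intrP[z ->].
have [zf|zf] := leP z (Num.floor r).
  have : (z%:~R : R) <= f by rewrite ler_int.
  by move=> h; rewrite ge_min; apply/orP; left; rewrite ger0_norm; lra.
have : f + 1 <= (z%:~R : R) by rewrite -[1]/(1%:~R) -intrD ler_int lezD1.
by move=> h; rewrite ge_min; apply/orP; right; rewrite ltr0_norm; lra.
Qed.

(** [tdist] separates points, because the lattice is discrete. This matters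
    because the Hoelder quotient of two points at distance [0] would be [0]
    (division by [0]) and carry no information. *)
Lemma tdist_gt0 x y : x != y -> 0 < tdist x y.
Proof.
move=> xy; pose v := repr x - repr y.
have s2 : 0 < Num.sqrt 2 :> R by rewrite sqrtr_gt0.
suff [e e0 he] : exists2 e : R, 0 < e & forall p q,
    \pi_(torus R) p = x -> \pi_(torus R) q = y -> e <= enorm (p - q).
  apply: (lt_le_trans e0); apply: lb_le_inf.
    by exists (enorm v), (repr x, repr y) => //=; rewrite !reprK.
  by move=> _ [p [px qy] <-]; exact: he.
have : ~~ lattice_rel (repr x) (repr y).
  by apply: contra xy => /pi_torusE; rewrite !reprK => ->.
have rel z p : \pi_(torus R) p = z -> lattice_rel (repr z) p.
  by move=> <-; apply/pi_torusE; rewrite reprK.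
rewrite negb_and => /orP[] /non_int_dist[e e0 he].
  exists (e * Num.sqrt 2) => [|p q /rel/andP[px _] /rel/andP[qy _]].
    exact: mulr_gt0.
  apply: le_trans (normr_fst_le_enorm _).
  rewrite -ler_pdivlMr// -[X in _ / X]gtr0_norm// -normf_div.
  have /he : ((repr x).1 - p.1) / Num.sqrt 2 - ((repr y).1 - q.1) / Num.sqrt 2
      \is a Num.int by exact: rpredB.
  by congr (_ <= `| _ |); rewrite /=; ring.
exists e => // p q /rel/andP[_ px] /rel/andP[_ qy].
apply: le_trans (normr_snd_le_enorm _).
have /he : (repr x).2 - p.2 - ((repr y).2 - q.2) \is a Num.int.
  exact: rpredB.
by congr (_ <= `| _ |); rewrite /=; ring.
Qed.

Lemma continuous_enorm : continuous (@enorm R).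
Proof.
move=> v; apply: continuous_comp; last exact: sqrt_continuous.
by apply: cvgD; apply: cvgM; by [exact: cvg_fst|exact: cvg_snd].
Qed.

(** The preimage of a ball in the plane is the union of the Euclidean balls
    around all the lifts of its centre. *)
Lemma open_tdist_lt a (r : R) : open [set y | tdist y a < r].
Proof.
change (open (\pi_(torus R) @^-1` [set y | tdist y a < r])).
have -> : \pi_(torus R) @^-1` [set y | tdist y a < r] =
    \bigcup_(q in [set q | \pi_(torus R) q = a])
      ((fun p => enorm (p - q)) @^-1` `]-oo, r[).
  apply/seteqP; split => p /=; last first.
    by move=> [q <-] /=; rewrite in_itv/=; exact: le_lt_trans (tdist_le _ _).
  move=> /inf_lt[].
    by exists (enorm (p - repr a)), (p, repr a); rewrite //= reprK.
  move=> _ [[p' q'] /= [/pi_torusE pp' qa] <-] lr.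
  (* The lift of [a] that is in the same position with respect to [p] as [q']
     is with respect to [p']. *)
  exists (q' + (p - p')); rewrite /= ?in_itv/=.
    rewrite -qa; apply/pi_torusE; move: pp' => /andP[h1 h2].
    apply/andP; split.
      rewrite (_ : _ / _ = - ((p'.1 - p.1) / Num.sqrt 2)) ?rpredN//=; ring.
    rewrite (_ : _ - _ = - (p'.2 - p.2)) ?rpredN//=; ring.
  rewrite (_ : p - (q' + (p - p')) = p' - q')//.
  by rewrite opprD opprB addrCA [p + _]addrCA subrr addr0 addrC.
apply: bigcup_open => q _; apply: open_comp => [p _|].
  apply: continuous_comp; last exact: continuous_enorm.
  by apply: cvgB => //; exact: cvg_cst.
exact: interval_open.
Qed.

Lemma measurable_tdist a : measurable_fun [set: torus R] (fun y => tdist y a).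
Proof.
apply: (measurability _ (RGenInftyO.measurableE R)) => _ [_ [r ->] <-].
rewrite setTI; apply: sub_sigma_algebra.
rewrite [X in open X](_ : _ = [set y | tdist y a < r]).
  exact: open_tdist_lt.
by apply/seteqP; split => y /=; rewrite in_itv.
Qed.

End torus_distance.

(** * Hoelder norms *)

Section holder.
Local Open Scope quotient_scope.
Context {R : realType}.
Implicit Types (x y : torus R) (f : torus R -> R * R) (alpha : R).

Lemma torus_nontrivial : exists p : torus R * torus R, p.1 != p.2.
Proof.
exists (\pi_(torus R) (0, 0), \pi_(torus R) (0, 2^-1)) => /=.
apply/eqP => /pi_torusE/andP[_ /=].
rewrite sub0r rpredN => /intrP[z hz].
have z0 : 0 < z by rewrite -(ltr_int R) -hz; lra.
have z1 : z < 1 by rewrite -(ltr_int R) -hz; lra.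
lia.
Qed.

(** Both suprema in [holder_norm] are over nonempty sets of nonnegative numbers,
    so that their sum dominates each of them. *)
Lemma holder_norm_terms_ge0 alpha f :
  [/\ (0 <= ereal_sup [set (enorm (f x))%:E | x in [set: torus R]])%E,
      (0 <= ereal_sup [set (enorm (f p.1 - f p.2) / tdist p.1 p.2 `^ alpha)%:E
          | p in [set p : torus R * torus R | p.1 != p.2]])%E &
      (0 <= holder_norm alpha f)%E].
Proof.
have h1 : (0 <= ereal_sup [set (enorm (f x))%:E | x in [set: torus R]])%E.
  apply: (@le_trans _ _ (enorm (f point))%:E).
    by rewrite lee_fin enorm_ge0.
  by apply: ereal_sup_ubound; exists point.
have h2 : (0 <= ereal_sup
    [set (enorm (f p.1 - f p.2) / tdist p.1 p.2 `^ alpha)%:E |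
      p in [set p : torus R * torus R | p.1 != p.2]])%E.
  have [p pP] := torus_nontrivial.
  apply: (@le_trans _ _
      (enorm (f p.1 - f p.2) / tdist p.1 p.2 `^ alpha)%:E).
    by rewrite lee_fin divr_ge0 ?enorm_ge0 ?powR_ge0.
  by apply: ereal_sup_ubound; exists p.
by split => //; rewrite adde_ge0.
Qed.

Lemma holder_normP alpha f (M : R) x y : alpha != 0 ->
  (holder_norm alpha f <= M%:E)%E ->
  enorm (f x - f y) <= M * tdist x y `^ alpha.
Proof.
move=> a0 fM; have [->|xy] := eqVneq x y.
  have [_ _ h] := holder_norm_terms_ge0 alpha f.
  rewrite subrr /enorm expr0n addr0 sqrtr0 mulr_ge0 ?powR_ge0//.
  by rewrite -lee_fin (le_trans h).
have [h1 _ _] := holder_norm_terms_ge0 alpha f.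
rewrite -ler_pdivrMr ?powR_gt0 ?tdist_gt0// -lee_fin.
apply: le_trans fM; apply: le_trans (leeDr _ h1).
by apply: ereal_sup_ubound; exists (x, y).
Qed.

Lemma Linf_holder_norm_ge0 alpha (u : R -> torus R -> R * R) :
  (0 <= Linf_holder_norm alpha u)%E.
Proof.
apply: ess_sup_gee.
  by rewrite -(set_itvNyy R)/= lebesgue_measure_itv/= addye.
apply: nearW => s; rewrite patchE; case: ifP => // _.
by case: (holder_norm_terms_ge0 alpha (u s)).
Qed.

Lemma Linf_holderP alpha (u : R -> torus R -> R * R) : 0 < alpha ->
  Linf_holder alpha u ->
  {ae lebesgue_measure, forall s, `[0, 1]%classic s -> forall x y,
    enorm (u s x - u s y) <=
      fine (Linf_holder_norm alpha u) * tdist x y `^ alpha}.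
Proof.
move=> a0 [_ uoo]; have := ess_sup_ge lebesgue_measure
  ((fun t => holder_norm alpha (u t)) \_ `[0%R, 1%R]).
apply: filterS => s; rewrite patchE => + s01 x y; rewrite mem_set// => h.
apply: holder_normP; first by rewrite gt_eqF.
by rewrite fineK// ge0_fin_numE ?Linf_holder_norm_ge0.
Qed.

End holder.

(** * Integrals on segments *)

Section real_integrals.
Context {R : realType}.
Notation mu := (@lebesgue_measure R).

Lemma lebesgue_measure_segment0 (t : R) : 0 <= t -> mu `[0, t] = t%:E.
Proof.
rewrite lebesgue_measure_itv/= lte_fin le_eqVlt => /orP[/eqP<-|->].
  by rewrite ltxx.
by rewrite oppr0 adde0.
Qed.

Lemma continuous_segment_integrable (t : R) (f : R -> R) :
  {within `[0, t], continuous f} -> mu.-integrable `[0, t] (EFin \o f).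
Proof.
move=> cf; apply: continuous_compact_integrable => //.
exact: segment_compact.
Qed.

Lemma ae_le_Rintegral d (T : measurableType d) (mu : {measure set T -> \bar R})
    (D : set T) (f g : T -> R) : measurable D ->
  mu.-integrable D (EFin \o f) -> mu.-integrable D (EFin \o g) ->
  (forall x, D x -> 0 <= f x) -> (forall x, D x -> 0 <= g x) ->
  {ae mu, forall x, D x -> f x <= g x} ->
  \int[mu]_(x in D) f x <= \int[mu]_(x in D) g x.
Proof.
move=> mD fi gi f0 g0 fg; apply: fine_le; try exact: integrable_fin_num.
apply: ae_ge0_le_integral => //.
  exact: measurable_int fi.
exact: measurable_int gi.
Qed.

(** [filterS] for the almost everywhere filter of a measure. *)
Lemma ae_imply d (T : measurableType d) (mu : {measure set T -> \bar R})
    (A B : T -> Prop) : (forall x, A x -> B x) ->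
  {ae mu, forall x, A x} -> {ae mu, forall x, B x}.
Proof. exact: filterS. Qed.

(** Jensen's inequality for the square and the average over [[0, t]]. *)
Lemma sqr_average_le (t : R) (f : R -> R) : 0 <= t ->
  {within `[0, t], continuous f} ->
  (t^-1 * \int[mu]_(s in `[0, t]) f s) ^+ 2 <=
    t^-1 * \int[mu]_(s in `[0, t]) (f s ^+ 2).
Proof.
rewrite le_eqVlt => /orP[/eqP<-|t0] cf.
  by rewrite invr0 !mul0r expr0n.
set m := t^-1 * _.
have ci (k : R) : {within `[0, t], continuous (cst k : R -> R)}.
  by move=> s; exact: cvg_cst.
have if1 := continuous_segment_integrable _ _ cf.
have cmf : {within `[0, t], continuous (fun s => (2 * m) * f s)}.
  by move=> s; apply: cvgM; [exact: cvg_cst|exact: cf].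
have cmf2 : {within `[0, t], continuous (fun s => (2 * m) * f s - m ^+ 2)}.
  by move=> s; apply: cvgB; [exact: cmf|exact: cvg_cst].
have cf2 : {within `[0, t], continuous (fun s => f s ^+ 2)}.
  by move=> s; apply: cvgM; exact: cf.
have mD : measurable (`[0, t] : set (measurableTypeR R)) by [].
(* The tangent inequality [2 m y - m ^ 2 <= y ^ 2], integrated. *)
have : \int[mu]_(s in `[0, t]) (2 * m * f s - m ^+ 2) <=
    \int[mu]_(s in `[0, t]) (f s ^+ 2).
  apply: le_Rintegral => //; try exact: continuous_segment_integrable.
  move=> s _; have := sqr_ge0 (f s - m); rewrite sqrrB; lra.
have im := continuous_segment_integrable _ _ (ci (m ^+ 2)).
have imf := continuous_segment_integrable _ _ cmf.
rewrite (RintegralB mD imf im) RintegralZl// Rintegral_cst//.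
have mut : fine (mu `[0, t]) = t by rewrite lebesgue_measure_segment0 ?(ltW t0).
rewrite mut.
have -> : \int[mu]_(s in `[0, t]) f s = t * m by rewrite mulVKf// gt_eqF.
move=> h; rewrite ler_pdivlMl//; apply: le_trans h.
by rewrite [leLHS](_ : _ = 2 * m * (t * m) - m ^+ 2 * t)//; ring.
Qed.

End real_integrals.

(** * Nonlinear Gronwall inequality *)

Section holder_path.
Context {R : realType}.
Notation mu := (@lebesgue_measure R).

(** Concave powers lie below an affine function, at any prescribed level [c]. *)
Lemma powR_le_linear (alpha a c : R) : 0 < alpha -> alpha < 1 -> 0 < c ->
  0 <= a -> a `^ alpha <= c `^ alpha + c `^ (alpha - 1) * a.
Proof.
move=> al0 al1 c0 a0; have [ac|ca] := leP a c.
  apply: ler_wpDr; first by rewrite mulr_ge0 ?powR_ge0.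
  by apply: ge0_ler_powR => //; rewrite ?nnegrE ltW.
have {}a0 : 0 < a by exact: lt_trans ca.
rewrite ler_wpDl ?powR_ge0//.
have -> : a `^ alpha = a `^ (alpha - 1) * a.
  rewrite -[in LHS](subrK 1 alpha) (@powRD _ a _ 1).
    by rewrite powRr1// ltW.
  by rewrite (gt_eqF a0) implybT.
apply: ler_wpM2r; first exact: ltW.
rewrite -(opprB 1) !powRN lef_pV2 ?posrE ?powR_gt0//.
by apply: ge0_ler_powR; rewrite ?nnegrE ?subr_ge0; exact: ltW.
Qed.

(** A nonlinear Gronwall inequality. [d1], [d2] are the components of the
    difference of the velocities along two paths, [D] the resulting difference
    of displacements and [N] the size of the difference of the noises. For the
    maximal displacement [S], the hypothesis gives
    [S <= 2 M t c ^ alpha + 2 M c ^ (alpha - 1) (t S + \int N)] for every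
    [c > 0]. The noise only enters through its time average. *)
Lemma holder_drift_bound (alpha M t : R) (d1 d2 N : R -> R)
    (D := fun (d : R -> R) (s : R) => \int[mu]_(r in `[0, s]) d r) :
  0 < alpha -> alpha < 1 -> 0 <= M -> 0 <= t ->
  mu.-integrable `[0, t] (EFin \o d1) -> mu.-integrable `[0, t] (EFin \o d2) ->
  mu.-integrable `[0, t] (EFin \o N) -> (forall s, 0 <= N s) ->
  {ae mu, forall s, `[0, t]%classic s ->
    `|d1 s| <= M * (`|D d1 s| + `|D d2 s| + N s) `^ alpha /\
    `|d2 s| <= M * (`|D d1 s| + `|D d2 s| + N s) `^ alpha} ->
  `|D d1 t| + `|D d2 t| <=
    (4 * M * t) `^ (1 - alpha)^-1 + t^-1 * \int[mu]_(s in `[0, t]) N s.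
Proof.
move=> al0 al1 M0 t0 id1 id2 iN N0 dN.
pose J := \int[mu]_(s in `[0, t]) N s; rewrite -/J.
pose B (d : R -> R) : R := \int[mu]_(s in `[0, t]) `|d s|.
have mD : measurable (`[0, t] : set (measurableTypeR R)) by [].
have J0 : 0 <= J by apply: Rintegral_ge0.
have mut : fine (mu `[0, t]) = t by rewrite lebesgue_measure_segment0.
have DB (d : R -> R) (s : R) : mu.-integrable `[0, t] (EFin \o d) ->
    0 <= s <= t -> `|D d s| <= B d.
  move=> id /andP[s0 st].
  have sub : `[0, s] `<=` `[0, t] by apply: subset_itvl; rewrite bnd_simp.
  have ids : mu.-integrable `[0, s] (EFin \o d) by exact: integrableS id.
  apply: (le_trans (le_normr_Rintegral _ ids)) => //.
  apply: fine_le.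
  - by apply: integrable_fin_num => //; exact: (integrable_norm ids).
  - by apply: integrable_fin_num => //; exact: (integrable_norm id).
  apply: ge0_subset_integral => //.
  by have := measurable_int _ (integrable_norm id).
pose S := sup [set `|D d1 s| + `|D d2 s| | s in `[0, t]].
have supS : has_sup [set `|D d1 s| + `|D d2 s| | s in `[0, t]].
  split.
    by exists (`|D d1 0| + `|D d2 0|), 0 => //=; rewrite in_itv/= lexx.
  exists (B d1 + B d2) => _ [s /= + <-]; rewrite in_itv/= => st.
  by rewrite lerD ?DB.
have leS (s : R) : 0 <= s <= t -> `|D d1 s| + `|D d2 s| <= S.
  by move=> st; apply: ub_le_sup; [exact: supS.2|exists s].
have S0 : 0 <= S by apply: le_trans (leS 0 _); rewrite ?addr_ge0 ?lexx.
(* The drift is bounded by linearizing the power at an arbitrary level [c]. *)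
have key (c : R) (d : R -> R) : 0 < c -> mu.-integrable `[0, t] (EFin \o d) ->
    {ae mu, forall s, `[0, t]%classic s ->
       `|d s| <= M * (`|D d1 s| + `|D d2 s| + N s) `^ alpha} ->
    B d <= M * (c `^ alpha * t) + M * (c `^ (alpha - 1) * (S * t + J)).
  move=> c0 id hd.
  have icst (k : R) : mu.-integrable `[0, t] (EFin \o cst k).
    by apply: continuous_segment_integrable => x; exact: cvg_cst.
  have iSN : mu.-integrable `[0, t] (EFin \o (fun s => S + N s)).
    by have := integrableD mD (icst S) iN.
  have icSN : mu.-integrable `[0, t]
      (EFin \o (fun s => c `^ (alpha - 1) * (S + N s))).
    by have := integrableZl mD (c `^ (alpha - 1)) iSN.
  have icc : mu.-integrable `[0, t]
      (EFin \o (fun s => c `^ alpha + c `^ (alpha - 1) * (S + N s))).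
    by have := integrableD mD (icst (c `^ alpha)) icSN.
  have -> : M * (c `^ alpha * t) + M * (c `^ (alpha - 1) * (S * t + J)) =
    \int[mu]_(s in `[0, t]) (M * (c `^ alpha + c `^ (alpha - 1) * (S + N s))).
    rewrite RintegralZl// RintegralD//; last exact: icst.
    rewrite Rintegral_cst// RintegralZl// RintegralD//; last exact: icst.
    by rewrite Rintegral_cst// mut -[LHS]mulrDr.
  apply: ae_le_Rintegral => //.
  - exact: (integrable_norm id).
  - by have := integrableZl mD M icc.
  - move=> s _; rewrite mulr_ge0// addr_ge0 ?powR_ge0// mulr_ge0 ?powR_ge0//.
    by rewrite addr_ge0.
  apply: ae_imply hd => s hs st; apply: le_trans (hs st) _.
  rewrite ler_wpM2l//; apply: le_trans (powR_le_linear _ _ _ al0 al1 c0 _) _.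
    by rewrite !addr_ge0.
  by rewrite lerD2l ler_wpM2l ?powR_ge0// lerD2r leS.
have dN1 : {ae mu, forall s, `[0, t]%classic s ->
    `|d1 s| <= M * (`|D d1 s| + `|D d2 s| + N s) `^ alpha}.
  by apply: ae_imply dN => s h /h[].
have dN2 : {ae mu, forall s, `[0, t]%classic s ->
    `|d2 s| <= M * (`|D d1 s| + `|D d2 s| + N s) `^ alpha}.
  by apply: ae_imply dN => s h /h[].
have key1 c (c0 : 0 < c) := key c d1 c0 id1 dN1.
have {key}key2 c (c0 : 0 < c) := key c d2 c0 id2 dN2.
have tt : 0 <= t <= t by rewrite t0 lexx.
(* Degenerate case: any level, say [c = 1], shows that there is no drift. *)
have [Mt|] := eqVneq (M * t) 0.
  have MJ : M * J = 0.
    move/eqP: Mt; rewrite mulf_eq0 => /orP[/eqP->|/eqP te].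
      by rewrite mul0r.
    by rewrite /J te set_itv1 Rintegral_set1 mulr0.
  have e : M * (1 `^ alpha * t) + M * (1 `^ (alpha - 1) * (S * t + J)) = 0.
    by rewrite !powR1 !mul1r mulrDr MJ addr0 mulrCA Mt mulr0 addr0.
  have b1 : `|D d1 t| <= 0 by rewrite -e (le_trans (DB _ _ id1 tt))// key1.
  have b2 : `|D d2 t| <= 0 by rewrite -e (le_trans (DB _ _ id2 tt))// key2.
  apply: le_trans (lerD b1 b2) _.
  by rewrite addr0 addr_ge0 ?powR_ge0// mulr_ge0 ?invr_ge0.
rewrite mulf_eq0 negb_or => /andP[Mn0 tn0].
have Mgt0 : 0 < M by rewrite lt_neqAle eq_sym Mn0.
have tgt0 : 0 < t by rewrite lt_neqAle eq_sym tn0.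
(* At this level [M t c ^ (alpha - 1) = 1 / 4], so that the two components
   together contribute [S / 2], which the left-hand side absorbs. *)
set c := (4 * M * t) `^ (1 - alpha)^-1.
have q0 : 0 < 4 * M * t by rewrite !mulr_gt0.
have c0 : 0 < c by rewrite powR_gt0.
have ca1 : c `^ (alpha - 1) = (4 * M * t)^-1.
  rewrite -powRrM -(opprB 1 alpha) mulrN mulVf ?gt_eqF ?subr_gt0//.
  by rewrite powRN powRr1// ltW.
have ca : c `^ alpha = c / (4 * M * t).
  have c1 : c `^ 1 = c by rewrite powRr1// ltW.
  rewrite -ca1 -[X in X * _]c1 -powRD ?(gt_eqF c0) ?implybT//.
  by congr (_ `^ _); ring.
have SB : S <= B d1 + B d2.
  apply: ge_sup; first exact: supS.1.
  by move=> _ [s /= + <-]; rewrite in_itv/= => st; rewrite lerD ?DB.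
have : S <= c + t^-1 * J.
  have := le_trans SB (lerD (key1 c c0) (key2 c c0)).
  rewrite ca ca1.
  have -> : M * (c / (4 * M * t) * t) + M * ((4 * M * t)^-1 * (S * t + J)) +
    (M * (c / (4 * M * t) * t) + M * ((4 * M * t)^-1 * (S * t + J))) =
    2^-1 * (c + (S + t^-1 * J)) by field; rewrite tn0 Mn0.
  lra.
exact: le_trans (leS t tt).
Qed.

End holder_path.

(** * Second moments of Gaussian variables and of Brownian motion *)

Section gaussian_second_moment.
Context {R : realType}.
Notation mu := (@lebesgue_measure R).

(** Integration against a density. *)
Lemma ge0_integral_normal_prob (m s : R) (f : R -> \bar R) :
  measurable_fun setT f -> (forall x, 0 <= f x)%E ->
  (\int[normal_prob m s]_x f x = \int[mu]_x (f x * (normal_pdf m s x)%:E))%E.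
Proof.
move=> mf f0; have dom := normal_prob_dominates m s.
rewrite -(Radon_Nikodym_SigmaFinite.change_of_variables dom)//.
apply: ae_eq_integral => //.
- apply: emeasurable_funM => //.
  exact: measurable_int (Radon_Nikodym_SigmaFinite.f_integrable dom).
- apply: emeasurable_funM => //; apply/measurable_EFinP.
  exact: measurable_normal_pdf.
apply: ae_eqe_mul2l; apply: integral_ae_eq => //.
- exact: Radon_Nikodym_SigmaFinite.f_integrable.
- by apply/measurable_EFinP; exact: measurable_normal_pdf.
by move=> E _ mE; rewrite -Radon_Nikodym_SigmaFinite.f_integral.
Qed.

(** The constant is not optimal. By [1 + y <= exp y] with
    [y = x ^ 2 / (4 s ^ 2)], the function [x ^ 2] times the density of standard
    deviation [s] is at most [8 s ^ 2] times the density of standard deviation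
    [sqrt 2 s]. *)
Lemma normal_second_moment (s : R) : 0 < s ->
  (\int[normal_prob 0 s]_x (x ^+ 2)%:E <= (8 * s ^+ 2)%:E)%E.
Proof.
move=> s0; rewrite ge0_integral_normal_prob//; last 2 first.
- by apply/measurable_EFinP; exact: measurable_funX.
- by move=> x; rewrite lee_fin sqr_ge0.
have s20 : 0 < Num.sqrt 2 * s by rewrite mulr_gt0 ?sqrtr_gt0.
have -> : (8 * s ^+ 2)%:E =
    (\int[mu]_x ((8 * s ^+ 2)%:E * (normal_pdf 0 (Num.sqrt 2 * s) x)%:E))%E.
  rewrite ge0_integralZl//.
  - by rewrite integral_normal_pdf mule1.
  - by apply/measurable_EFinP; exact: measurable_normal_pdf.
  - by move=> x _; rewrite lee_fin normal_pdf_ge0.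
  - by rewrite lee_fin mulr_ge0 ?sqr_ge0.
apply: ge0_le_integral => //.
- by move=> x _; rewrite -EFinM lee_fin mulr_ge0 ?sqr_ge0 ?normal_pdf_ge0.
- apply/measurable_EFinP/measurable_funM; first exact: measurable_funX.
  exact: measurable_normal_pdf.
- apply/measurable_EFinP/measurable_funM => //.
  exact: measurable_normal_pdf.
move=> x _; rewrite -!EFinM lee_fin !normal_pdfE ?gt_eqF//.
have pk : normal_peak s <= 2 * normal_peak (Num.sqrt 2 * s).
  rewrite /normal_peak.
  have -> : (Num.sqrt 2 * s) ^+ 2 * pi *+ 2 = 2 * (s ^+ 2 * pi *+ 2).
    by rewrite exprMn sqr_sqrtr//; ring.
  rewrite sqrtrM// invfM mulrA ler_peMl ?invr_ge0 ?sqrtr_ge0//.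
  rewrite ler_pdivlMr ?sqrtr_gt0// mul1r -[leRHS]ger0_norm// -sqrtr_sqr.
  by rewrite ler_wsqrtr//; lra.
have ef : x ^+ 2 * normal_fun 0 s x <=
    4 * s ^+ 2 * normal_fun 0 (Num.sqrt 2 * s) x.
  rewrite /normal_fun subr0 exprMn sqr_sqrtr//.
  have -> : - x ^+ 2 / (s ^+ 2 *+ 2) = x ^+ 2 / (4 * s ^+ 2) * (- 2).
    by field; rewrite gt_eqF.
  have -> : - x ^+ 2 / ((2 * s ^+ 2) *+ 2) = x ^+ 2 / (4 * s ^+ 2) * (- 1).
    by field; rewrite gt_eqF.
  set y := x ^+ 2 / (4 * s ^+ 2).
  have -> : x ^+ 2 = 4 * s ^+ 2 * y by rewrite /y; field; rewrite gt_eqF.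
  rewrite -mulrA ler_pM2l ?mulr_gt0 ?exprn_gt0//.
  have -> : y * -1 = y + y * (- 2) by ring.
  rewrite expRD ler_wpM2r ?expR_ge0//.
  by apply: le_trans (expR_ge1Dx y); rewrite lerDr.
have -> : 8 * s ^+ 2 *
      (normal_peak (Num.sqrt 2 * s) * normal_fun 0 (Num.sqrt 2 * s) x) =
    2 * normal_peak (Num.sqrt 2 * s) *
      (4 * s ^+ 2 * normal_fun 0 (Num.sqrt 2 * s) x) by ring.
rewrite mulrCA ler_pM ?normal_peak_ge0//.
by rewrite mulr_ge0 ?sqr_ge0 ?normal_fun_ge0.
Qed.

(** Square of the Euclidean norm of the plane. *)
Definition sqnorm (v : R * R) : R := v.1 ^+ 2 + v.2 ^+ 2.

Lemma sqnorm_ge0 (v : R * R) : 0 <= sqnorm v.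
Proof. by rewrite addr_ge0 ?sqr_ge0. Qed.

Lemma measurable_sqnorm : measurable_fun [set: R * R] sqnorm.
Proof.
apply: measurable_funD; apply: measurable_funX;
  [exact: measurable_fst|exact: measurable_snd].
Qed.

End gaussian_second_moment.

Section brownian.
Context {d} {Om : measurableType d} {R : realType} (P : probability Om R).
Variables (F : R -> set (set Om)) (w : R -> {RV P >-> (R * R)%type}).
Hypothesis wB : is_brownian_motion F w.

Lemma brownian_second_moment (r : R) : 0 <= r ->
  (\int[P]_om (sqnorm (w r om))%:E <= (16 * r)%:E)%E.
Proof.
have mq (r' : R) : measurable_fun setT (fun om => (sqnorm (w r' om))%:E).
  apply/measurable_EFinP; apply: measurableT_comp.
    exact: measurable_sqnorm.
  exact: measurable_funP.
rewrite le_eqVlt => /orP[/eqP<-|r0].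
  rewrite mulr0 -[leRHS](integral0 P setT).
  apply: (@ae_ge0_le_integral _ _ _ P setT measurableT _ (cst 0%E)) => //.
  - by move=> om _; rewrite lee_fin sqnorm_ge0.
  - have := brownian_start wB; apply: filterS => om -> _.
    by rewrite /sqnorm /= expr0n addr0.
pose phi om := w r om - w 0 om.
(* [normal_prob] is a measure on [measurableTypeR R], whose measurable sets are
   those of [R] but whose display differs, hence the change of codomain. *)
have mphi : measurable_fun setT
    (phi : Om -> measurableTypeR R * measurableTypeR R).
  have mw (r' : R) : measurable_fun setT
      (w r' : Om -> measurableTypeR R * measurableTypeR R).
    exact: (measurable_funP (w r')).
  apply/measurable_fun_pairP; split.
    by apply: measurable_funB; apply: measurableT_comp (mw _).
  by apply: measurable_funB; apply: measurableT_comp (mw _).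
have mE : measurable_fun setT
    (fun v : measurableTypeR R * measurableTypeR R => (sqnorm v)%:E).
  by apply/measurable_EFinP; exact: measurable_sqnorm.
apply: (@le_trans _ _ (\int[P]_om (sqnorm (phi om))%:E)%E).
  apply: ae_ge0_le_integral => //.
  - by move=> om _; rewrite lee_fin sqnorm_ge0.
  - by move=> om _; rewrite lee_fin sqnorm_ge0.
  - exact: measurableT_comp mE mphi.
  - have := brownian_start wB; apply: filterS => om w0 _.
    by rewrite /phi w0 subr0.
pose Phi : {RV P >-> (measurableTypeR R * measurableTypeR R)%type} :=
  HB.pack phi (isMeasurableFun.Build _ _ _ _ _ mphi).
rewrite -(ge0_integral_distribution Phi mE); last first.
  by move=> v; rewrite lee_fin sqnorm_ge0.
pose N := normal_prob 0 (Num.sqrt (r - 0)).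
have -> : (\int[distribution P Phi]_v (sqnorm v)%:E =
    \int[(N \x N)%E]_v (sqnorm v)%:E)%E.
  apply: eq_measure_integral => A mA _.
  exact: (brownian_increment wB (lexx 0) r0 mA).
rewrite fubini_tonelli1//; last by move=> v; rewrite lee_fin sqnorm_ge0.
have NC (k : R) : (\int[normal_prob 0 (Num.sqrt (r - 0))]__ k%:E = k%:E)%E.
  rewrite integral_cst// -[RHS]mule1; congr (_ * _)%E.
  exact: (@probability_setT _ _ _ (normal_prob 0 (Num.sqrt (r - 0)))).
have sr : 0 < Num.sqrt (r - 0) by rewrite subr0 sqrtr_gt0.
have N2 : (\int[N]_x (x ^+ 2)%:E <= (8 * r)%:E)%E.
  apply: le_trans (normal_second_moment _ sr) _.
  by rewrite subr0 sqr_sqrtr// ltW.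
have mX2 : measurable_fun [set: R] (fun x : R => (x ^+ 2)%:E).
  by apply/measurable_EFinP; exact: measurable_funX.
have inner x : (fubini_F N (fun v : R * R => (sqnorm v)%:E) x <=
    (x ^+ 2)%:E + (8 * r)%:E)%E.
  rewrite /fubini_F/= /N; under eq_integral do rewrite EFinD.
  rewrite ge0_integralD//=; last 2 first.
  - by move=> y _; rewrite lee_fin sqr_ge0.
  - by move=> y _; rewrite lee_fin sqr_ge0.
  by rewrite NC leeD2l.
apply: (@le_trans _ _ (\int[N]_x ((x ^+ 2)%:E + (8 * r)%:E))%E).
  apply: ge0_le_integral => //.
  - by move=> x _; apply: integral_ge0 => y _; rewrite lee_fin sqnorm_ge0.
  - apply: measurable_fun_fubini_tonelli_F => // v.
    by rewrite lee_fin sqnorm_ge0.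
  - exact: emeasurable_funD.
  - by move=> x _; exact: inner.
rewrite ge0_integralD//=; last 2 first.
- by move=> y _; rewrite lee_fin sqr_ge0.
- by move=> y _; rewrite lee_fin mulr_ge0// ltW.
rewrite NC.
have -> : 16 * r = 8 * r + 8 * r by ring.
by rewrite EFinD leeD2r.
Qed.

End brownian.

(** * Time averages of a continuous process *)

Section grid.
Context {R : realType}.

(** Largest multiple of [1 / (n + 1)] below [s], for [0 <= s]. *)
Definition grid (n : nat) (s : R) : R :=
  (Num.truncn (s * n.+1%:R))%:R / n.+1%:R.

Lemma grid_itv n s : 0 <= s -> 0 <= grid n s <= s.
Proof.
move=> s0; rewrite divr_ge0//= ler_pdivrMr// truncn_le.
by rewrite mulr_ge0.
Qed.

Lemma cvg_grid s : 0 <= s -> grid ^~ s @ \oo --> s.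
Proof.
move=> s0; apply: (@squeeze_cvgr _ _ _ _ (fun n => s - n.+1%:R^-1) (cst s)).
- apply: nearW => n; have /andP[_ ->] := grid_itv n s s0; rewrite andbT.
  rewrite lerBlDr /grid -[X in _ + X]mul1r -mulrDl ler_pdivlMr//.
  by rewrite ltW// natr1 truncnS_gt.
- rewrite -[X in _ --> X]subr0; apply: cvgB; first exact: cvg_cst.
  exact: cvg_harmonic.
- exact: cvg_cst.
Qed.

End grid.

Lemma limn_einf_le {R : realType} (u : (\bar R)^nat) (c : \bar R) :
  (forall n, u n <= c)%E -> (limn_einf u <= c)%E.
Proof.
move=> uc; rewrite limn_einf_lim; apply: lime_le; first exact: is_cvg_einfs.
apply: nearW => n; apply: le_trans (uc n); apply: ereal_inf_lbound.
by exists n => /=.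
Qed.

Section time_average.
Context {d} {Om : measurableType d} {R : realType} (P : probability Om R).
Notation mu := (@lebesgue_measure R).
Variable Y : R -> Om -> R.
Hypothesis mY : forall r, measurable_fun setT (Y r).
Hypothesis Y0 : forall r om, 0 <= Y r om.

(** A jointly measurable version of [fun p => Y p.1 p.2]: the lower limit of the
    discretizations in time. At nonnegative times it takes the same values along
    continuous paths, and it needs no exceptional set for the other paths. *)
Definition grid_limit (p : measurableTypeR R * Om) : \bar R :=
  limn_einf (fun n => (Y (grid n p.1) p.2)%:E).

Lemma grid_limit_ge0 p : (0 <= grid_limit p)%E.
Proof.
rewrite /grid_limit limn_einf_lim; apply: lime_ge; first exact: is_cvg_einfs.
apply: nearW => n; apply: le_ereal_inf_tmp => _ [k _ <-].
by rewrite lee_fin.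
Qed.

Lemma measurable_grid n : measurable_fun setT
  (fun p : measurableTypeR R * Om => (Y (grid n p.1) p.2)%:E).
Proof.
have E k : measurable [set p : measurableTypeR R * Om |
    Num.truncn (p.1 * n.+1%:R) = k].
  have mt : measurable_fun [set: measurableTypeR R * Om]
     (fun p : measurableTypeR R * Om => (Num.truncn (p.1 * n.+1%:R))%:R : R).
    apply: (@measurableT_comp _ _ _ _ _ _
      (fun s : R => (Num.truncn (s * n.+1%:R))%:R : R) _ fst) => //.
    apply: nondecreasing_measurable => // x y xy.
    by rewrite ler_nat le_truncn// ler_wpM2r.
  have := mt measurableT [set k%:R] (measurable_set1 _).
  rewrite setTI; congr (measurable _); apply/seteqP; split => p /=.
    by move/eqP; rewrite eqr_nat => /eqP.
  by move=> ->.
have cov : [set: measurableTypeR R * Om] =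
    \bigcup_k [set p : measurableTypeR R * Om |
      Num.truncn (p.1 * n.+1%:R) = k].
  by apply/seteqP; split => // p _; exists (Num.truncn (p.1 * n.+1%:R)).
rewrite cov; apply/measurable_fun_bigcup => // k.
apply: (eq_measurable_fun
  (fun p : measurableTypeR R * Om => (Y (k%:R / n.+1%:R) p.2)%:E)).
  by move=> p; rewrite inE /= /grid => ->.
apply: measurable_funTS; apply/measurable_EFinP.
exact: (measurableT_comp (mY _)).
Qed.

Lemma measurable_grid_limit : measurable_fun setT grid_limit.
Proof.
have -> : grid_limit =
    fun p => (- limn_esup (fun n => - (Y (grid n p.1) p.2)%:E))%E by [].
apply: measurableT_comp; first exact: oppe_measurable.
apply: (@measurable_fun_limn_esup _ _ _ _
  (fun n p => - (Y (grid n p.1) p.2)%:E)%E) => n.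
by apply: measurableT_comp; [exact: oppe_measurable|exact: measurable_grid].
Qed.

Lemma grid_limitE om s : {within `[0, +oo[, continuous (Y ^~ om)} -> 0 <= s ->
  grid_limit (s, om) = (Y s om)%:E.
Proof.
move=> cY s0; suff : (fun n => (Y (grid n s) om)%:E) @ \oo --> (Y s om)%:E.
  by move=> /cvg_limn_einf_sup[].
apply/fine_cvgP; split; first exact: nearW.
have /subspace_continuousP/(_ s) := cY.
rewrite /= in_itv/= s0 => /(_ isT) h.
apply: (cvg_comp (grid ^~ s) (Y ^~ om) _ h) => A nA.
have gA : \forall n \near \oo, `[0, +oo[%classic (grid n s) -> A (grid n s).
  exact: (cvg_grid s s0 _ nA).
suff : \forall n \near \oo, A (grid n s) by [].
apply: filterS gA => n; apply.
by rewrite /= in_itv/= andbT; have /andP[] := grid_itv n s s0.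
Qed.

(** The integral over [[0, t]] of the process [Y]. *)
Definition time_integral (t : R) (om : Om) : \bar R :=
  (\int[mu]_(s in `[0%R, t]) grid_limit (s, om))%E.

Lemma time_integral_ge0 t om : (0 <= time_integral t om)%E.
Proof. by apply: integral_ge0 => s _; exact: grid_limit_ge0. Qed.

Let cut (t : R) (p : measurableTypeR R * Om) : \bar R :=
  (grid_limit p * (\1_(`[0, t] : set R) p.1)%:E)%E.

Let mcut t : measurable_fun setT (cut t).
Proof.
apply: emeasurable_funM; first exact: measurable_grid_limit.
apply/measurable_EFinP.
exact: (@measurableT_comp _ _ _ _ _ _
  (\1_(`[0, t] : set R) : measurableTypeR R -> R) _ fst).
Qed.

Let cut_ge0 t p : (0 <= cut t p)%E.
Proof. by rewrite mule_ge0 ?grid_limit_ge0// lee_fin. Qed.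

Let time_integralE t om : time_integral t om = (\int[mu]_s cut t (s, om))%E.
Proof.
rewrite /time_integral integral_mkcond; apply: eq_integral => s _.
by rewrite epatch_indic.
Qed.

Lemma measurable_time_integral t : measurable_fun setT (time_integral t).
Proof.
have -> : time_integral t = (fun om => \int[mu]_s cut t (s, om))%E.
  by apply/funext => om; exact: time_integralE.
exact: (measurable_fun_fubini_tonelli_G (cut t) (mcut t) (cut_ge0 t)).
Qed.

(** Tonelli's theorem, then Fatou's lemma at each time. *)
Lemma expectation_time_integral (K t : R) : 0 <= K -> 0 <= t ->
  (forall r, 0 <= r -> (\int[P]_om (Y r om)%:E <= (K * r)%:E)%E) ->
  (\int[P]_om time_integral t om <= (K * t * t)%:E)%E.
Proof.
move=> K0 t0 YK.
under eq_integral do rewrite time_integralE.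
rewrite -(fubini_tonelli (cut t) (mcut t) (cut_ge0 t)).
rewrite EFinM -(lebesgue_measure_segment0 t t0) -integral_cst//.
rewrite integral_mkcond.
rewrite epatch_indic/=.
apply: ge0_le_integral => //.
- by move=> s _; apply: integral_ge0 => om _; exact: cut_ge0.
- exact: (measurable_fun_fubini_tonelli_F (cut t) (mcut t) (cut_ge0 t)).
- by apply: emeasurable_funM => //; apply/measurable_EFinP.
move=> s _; rewrite /cut/=.
under eq_integral do rewrite muleC.
rewrite ge0_integralZl//; last 2 first.
- exact: (measurableT_comp measurable_grid_limit).
- by move=> om _; exact: grid_limit_ge0.
rewrite muleC /indic; have [|_] := boolP (s \in _); last by rewrite !mule0.
rewrite inE/= in_itv/= => /andP[s0 st]; rewrite !mule1.
pose f n om := (Y (grid n s) om)%:E.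
have mf n : measurable_fun setT (f n) by exact/measurable_EFinP.
have f0 n om : [set: Om] om -> (0 <= f n om)%E by rewrite lee_fin.
apply: le_trans (fatou _ measurableT mf f0) _.
apply: limn_einf_le => n; have /andP[g0 gs] := grid_itv n s s0.
by apply: le_trans (YK _ g0) _; rewrite lee_fin ler_wpM2l// (le_trans gs).
Qed.

End time_average.

(** * Comparison of two trajectories *)

Section trajectories.
Context {R : realType}.
Notation mu := (@lebesgue_measure R).

(** The [l ^ 1] norm of the plane. *)
Definition l1 (v : R * R) : R := `|v.1| + `|v.2|.

Lemma l1_ge0 v : 0 <= l1 v. Proof. by rewrite addr_ge0. Qed.

Lemma sqr_l1_le v w : (l1 v + l1 w) ^+ 2 <= 4 * (sqnorm v + sqnorm w).
Proof.
rewrite /sqnorm /l1 -[v.1 ^+ 2]real_normK ?num_real//.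
rewrite -[v.2 ^+ 2]real_normK ?num_real// -[w.1 ^+ 2]real_normK ?num_real//.
rewrite -[w.2 ^+ 2]real_normK ?num_real//.
set a := `|v.1|; set b := `|v.2|; set c := `|w.1|; set d := `|w.2|.
have -> : 4 * (a ^+ 2 + b ^+ 2 + (c ^+ 2 + d ^+ 2)) = (a + b + (c + d)) ^+ 2 +
  ((a - b) ^+ 2 + (a - c) ^+ 2 + (a - d) ^+ 2 +
   (b - c) ^+ 2 + (b - d) ^+ 2 + (c - d) ^+ 2) by ring.
by rewrite lerDl !addr_ge0 ?sqr_ge0.
Qed.

Lemma within_continuous_comp (A : set R) (f : R -> R * R) (g : R * R -> R) :
  continuous g -> {within A, continuous f} -> {within A, continuous (g \o f)}.
Proof.
move=> cg cf s.
exact: (@continuous_comp (subspace A) _ _ f g s (cf s) (cg _)).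
Qed.

Lemma continuous_l1 : continuous l1.
Proof.
move=> v; apply: cvgD; apply: cvg_norm; [exact: cvg_fst|exact: cvg_snd].
Qed.

Lemma continuous_sqnorm : continuous (@sqnorm R).
Proof.
move=> v; apply: cvgD; apply: cvgM;
  by [exact: cvg_fst|exact: cvg_snd].
Qed.

Variables (alpha : R) (u : R -> torus R -> R * R) (kappa : R) (x : torus R).
Hypotheses (alpha_gt0 : 0 < alpha) (alpha_lt1 : alpha < 1).
Hypothesis uL : Linf_holder alpha u.
Hypothesis kappa_ge0 : 0 <= kappa.

(** [p] solves the integral equation started at [x] with the deterministic noise
    path [b]. The solution of the stochastic equation has this property for
    almost every outcome. *)
Definition trajectory (b : R -> R * R) (p : R -> torus R) : Prop :=
  [/\ {within `[0, +oo[, continuous b},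
      mu.-integrable `[0, 1] (fun s => (u s (p s)).1%:E),
      mu.-integrable `[0, 1] (fun s => (u s (p s)).2%:E) &
      forall s : R, 0 <= s <= 1 -> p s = tadd x
        (\int[mu]_(r in `[0, s]) (u r (p r)).1 +
           Num.sqrt (2 * kappa) * (b s).1,
         \int[mu]_(r in `[0, s]) (u r (p r)).2 +
           Num.sqrt (2 * kappa) * (b s).2)].

(** Average over [[0, t]], plus final value, of the squared norm of the noise. At
    [t = 0] the average is [0], as the inverse of [0] is [0]. *)
Definition noise_cost (b : R -> R * R) (t : R) : R :=
  t^-1 * \int[mu]_(s in `[0, t]) sqnorm (b s) + sqnorm (b t).

(** Two solutions driven by different noises are close: the distance is at most
    the drift difference, bounded by [holder_drift_bound], plus the noise
    difference. *)
Lemma trajectories_close (b c : R -> R * R) (p q : R -> torus R) (t : R) :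
  trajectory b p -> trajectory c q -> 0 <= t -> t <= 1 ->
  tdist (p t) (q t) ^+ 2 <=
    3 * (4 * fine (Linf_holder_norm alpha u) * t) `^ (1 - alpha)^-1 ^+ 2 +
    24 * kappa * (noise_cost b t + noise_cost c t).
Proof.
move=> [cb ip1 ip2 pE] [cc iq1 iq2 qE] t0 t1.
set M := fine _.
have M0 : 0 <= M by rewrite fine_ge0// Linf_holder_norm_ge0.
pose k := Num.sqrt (2 * kappa).
have k0 : 0 <= k by exact: sqrtr_ge0.
have kk : k ^+ 2 = 2 * kappa by rewrite sqr_sqrtr// mulr_ge0.
pose N s := k * (l1 (b s) + l1 (c s)).
have N0 s : 0 <= N s by rewrite mulr_ge0// addr_ge0 ?l1_ge0.
pose d1 s := (u s (p s)).1 - (u s (q s)).1.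
pose d2 s := (u s (p s)).2 - (u s (q s)).2.
have mD s : measurable (`[0, s] : set (measurableTypeR R)) by [].
have sub (s : R) : s <= 1 -> [set` `[0, s]] `<=` `[0, 1]%classic.
  by move=> s1; apply: subset_itvl; rewrite bnd_simp.
have int_sub (f : R -> R) s : s <= 1 -> mu.-integrable `[0, 1] (EFin \o f) ->
    mu.-integrable `[0, s] (EFin \o f).
  by move=> s1; apply: integrableS => //; exact: sub.
have within (f : R -> R * R) : {within `[0, +oo[, continuous f} ->
    {within `[0, t], continuous f}.
  by apply: continuous_subspaceW => s /=; rewrite !in_itv/= => /andP[->].
have {}cb := within _ cb; have {}cc := within _ cc.
have cl1 (f : R -> R * R) : {within `[0, t], continuous f} ->
    {within `[0, t], continuous (fun s => l1 (f s))}.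
  exact: within_continuous_comp continuous_l1.
have csq (f : R -> R * R) : {within `[0, t], continuous f} ->
    {within `[0, t], continuous (fun s => sqnorm (f s))}.
  exact: within_continuous_comp continuous_sqnorm.
have cN : {within `[0, t], continuous N}.
  by move=> s; apply: cvgM; [exact: cvg_cst|apply: cvgD; exact: cl1].
have D1E s : s <= 1 -> \int[mu]_(r in `[0, s]) d1 r =
    \int[mu]_(r in `[0, s]) (u r (p r)).1 -
    \int[mu]_(r in `[0, s]) (u r (q r)).1.
  by move=> s1; rewrite RintegralB//; exact: int_sub.
have D2E s : s <= 1 -> \int[mu]_(r in `[0, s]) d2 r =
    \int[mu]_(r in `[0, s]) (u r (p r)).2 -
    \int[mu]_(r in `[0, s]) (u r (q r)).2.
  by move=> s1; rewrite RintegralB//; exact: int_sub.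
pose D s := `|\int[mu]_(r in `[0, s]) d1 r| + `|\int[mu]_(r in `[0, s]) d2 r|.
have dist s : 0 <= s <= 1 -> tdist (p s) (q s) <= D s + N s.
  move=> s01; have s1 : s <= 1 by case/andP: s01.
  rewrite pE// qE//; apply: le_trans (tdist_tadd _ _ _) _.
  apply: le_trans (enorm_le_l1 _) _; rewrite /= /D D1E// D2E// -/k /N /l1.
  set a1 := \int[mu]_(r in _) _; set a2 := \int[mu]_(r in _) _.
  set a3 := \int[mu]_(r in _) _; set a4 := \int[mu]_(r in _) _.
  have e a a' y y' :
      `|a + k * y - (a' + k * y')| <= `|a - a'| + k * (`|y| + `|y'|).
    have -> : a + k * y - (a' + k * y') = (a - a') + k * (y - y') by ring.
    apply: le_trans (ler_normD _ _) _; rewrite lerD2l normrM ger0_norm//.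
    by rewrite ler_wpM2l// ler_normB.
  have := e a1 a2 (b s).1 (c s).1; have := e a3 a4 (b s).2 (c s).2.
  lra.
have hu : {ae mu, forall s, `[0, t]%classic s ->
    `|d1 s| <= M * (D s + N s) `^ alpha /\
    `|d2 s| <= M * (D s + N s) `^ alpha}.
  apply: ae_imply (Linf_holderP alpha u alpha_gt0 uL) => s h st.
  have s01 : 0 <= s <= 1 by have := sub _ t1 _ st; rewrite /= in_itv.
  have {}h : enorm (u s (p s) - u s (q s)) <= M * (D s + N s) `^ alpha.
    apply: le_trans (h _ (p s) (q s)) _; first by rewrite /= in_itv.
    apply: (ler_wpM2l M0); apply: ge0_ler_powR (dist _ s01).
    - exact: ltW.
    - by rewrite nnegrE tdist_ge0.
    - by rewrite nnegrE !addr_ge0.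
  split; apply: le_trans h.
    exact: (normr_fst_le_enorm (_ - _)).
  exact: (normr_snd_le_enorm (_ - _)).
have id1 : mu.-integrable `[0, t] (EFin \o d1).
  have := integrableB (mD 1) ip1 iq1; exact: int_sub.
have id2 : mu.-integrable `[0, t] (EFin \o d2).
  have := integrableB (mD 1) ip2 iq2; exact: int_sub.
have iN := continuous_segment_integrable _ _ cN.
have key := holder_drift_bound alpha M t d1 d2 N alpha_gt0 alpha_lt1 M0 t0
  id1 id2 iN N0 hu.
set C := (4 * M * t) `^ (1 - alpha)^-1 in key *.
have C0 : 0 <= C by exact: powR_ge0.
have av0 : 0 <= t^-1 * \int[mu]_(s in `[0, t]) N s.
  by rewrite mulr_ge0 ?invr_ge0// Rintegral_ge0.
have NN s : N s ^+ 2 <= 8 * kappa * (sqnorm (b s) + sqnorm (c s)).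
  have -> : 8 * kappa * (sqnorm (b s) + sqnorm (c s)) =
    2 * kappa * (4 * (sqnorm (b s) + sqnorm (c s))) by ring.
  by rewrite exprMn kk ler_wpM2l ?sqr_l1_le// mulr_ge0.
have av : (t^-1 * \int[mu]_(s in `[0, t]) N s) ^+ 2 <= 8 * kappa *
   (t^-1 * \int[mu]_(s in `[0, t]) sqnorm (b s) +
    t^-1 * \int[mu]_(s in `[0, t]) sqnorm (c s)).
  apply: le_trans (sqr_average_le _ _ t0 cN) _.
  rewrite -mulrDr mulrCA ler_wpM2l ?invr_ge0//.
  have cs : {within `[0, t],
      continuous (fun s => sqnorm (b s) + sqnorm (c s))}.
    by move=> s; apply: cvgD; exact: csq.
  rewrite -RintegralD//;
    try by apply: continuous_segment_integrable; exact: csq.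
  rewrite -RintegralZl//; last exact: continuous_segment_integrable.
  apply: le_Rintegral => //; apply: continuous_segment_integrable.
    by move=> s; apply: cvgM; exact: cN.
  by move=> s; apply: cvgM; [exact: cvg_cst|exact: cs].
have tt : tdist (p t) (q t) <= C + t^-1 * \int[mu]_(s in `[0, t]) N s + N t.
  apply: le_trans (dist t _) _; first by rewrite t0.
  by rewrite lerD2r.
have : tdist (p t) (q t) ^+ 2 <=
    (C + t^-1 * \int[mu]_(s in `[0, t]) N s + N t) ^+ 2.
  by rewrite lerXn2r ?nnegrE ?tdist_ge0 ?addr_ge0.
move=> /le_trans; apply.
move: av (NN t); rewrite /noise_cost.
set A := t^-1 * \int[mu]_(s in `[0, t]) N s.
have := sqr_ge0 (C - A); have := sqr_ge0 (C - N t); have := sqr_ge0 (A - N t).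
rewrite !sqrrB !sqrrD; nra.
Qed.

End trajectories.

(** * Expected noise and conclusion *)

Section brownian_cost.
Context {d} {Om : measurableType d} {R : realType} (P : probability Om R).
Notation mu := (@lebesgue_measure R).
Variables (F : R -> set (set Om)) (w : R -> {RV P >-> (R * R)%type}).
Hypothesis wB : is_brownian_motion F w.

Let Y (r : R) (om : Om) : R := sqnorm (w r om).

Let mY r : measurable_fun setT (Y r).
Proof.
apply: measurableT_comp; first exact: measurable_sqnorm.
exact: measurable_funP.
Qed.

Let Y0 r om : 0 <= Y r om. Proof. exact: sqnorm_ge0. Qed.

(** A measurable version, on the whole probability space, of [noise_cost] along
    the Brownian path. *)
Definition mean_cost (t : R) (om : Om) : \bar R :=
  ((t^-1)%:E * time_integral Y t om + (Y t om)%:E)%E.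

Lemma mean_cost_ge0 t om : 0 <= t -> (0 <= mean_cost t om)%E.
Proof.
move=> t0; rewrite adde_ge0 ?lee_fin// mule_ge0 ?lee_fin ?invr_ge0//.
exact: time_integral_ge0.
Qed.

Lemma measurable_mean_cost t : measurable_fun setT (mean_cost t).
Proof.
apply: emeasurable_funD; last exact/measurable_EFinP.
by apply: emeasurable_funM => //; exact: measurable_time_integral.
Qed.

Lemma mean_cost_noise (t : R) om :
  {within `[0, +oo[, continuous (fun s => w s om)} -> 0 <= t ->
  mean_cost t om = (noise_cost (fun s => w s om) t)%:E.
Proof.
move=> cw t0.
have cY : {within `[0, +oo[, continuous (Y ^~ om)}.
  exact: within_continuous_comp continuous_sqnorm cw.
have cYt : {within `[0, t], continuous (Y ^~ om)}.
  by apply: continuous_subspaceW cY => s /=; rewrite !in_itv/= => /andP[->].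
have iY := continuous_segment_integrable _ _ cYt.
transitivity ((t^-1)%:E * (\int[mu]_(s in `[0%R, t]) Y s om)%R%:E +
    (Y t om)%:E)%E; last by rewrite -EFinM -EFinD.
congr (_ * _ + _)%E.
rewrite /time_integral /Rintegral fineK; last exact: integrable_fin_num.
apply: eq_integral => s; rewrite inE/= in_itv/= => /andP[s0 _].
exact: grid_limitE.
Qed.

Lemma expectation_mean_cost (t : R) : 0 <= t ->
  (\int[P]_om mean_cost t om <= (32 * t)%:E)%E.
Proof.
move=> t0; rewrite ge0_integralD//; last 4 first.
- move=> om _; rewrite mule_ge0 ?lee_fin ?invr_ge0//.
  exact: time_integral_ge0.
- by apply: emeasurable_funM => //; exact: measurable_time_integral.
- by move=> om _; rewrite lee_fin.
- exact/measurable_EFinP.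
rewrite ge0_integralZl//; last 3 first.
- exact: measurable_time_integral.
- by move=> om _; exact: time_integral_ge0.
- by rewrite lee_fin invr_ge0.
have E1 := expectation_time_integral P Y mY Y0 16 t (ler0n _ _) t0
  (brownian_second_moment P F w wB).
have E2 := brownian_second_moment P F w wB t t0.
have -> : (32 * t)%:E = ((t^-1)%:E * (16 * t * t)%:E + (16 * t)%:E)%E.
  rewrite -EFinM -EFinD; congr EFin.
  by have [->|tn0] := eqVneq t 0; [rewrite !mulr0 addr0|field].
by rewrite leeD// lee_wpmul2l// lee_fin invr_ge0.
Qed.

End brownian_cost.

Theorem proposition1p9 (R : realType) (alpha : R)
    (alpha_gt0 : 0 < alpha) (alpha_lt1 : alpha < 1) :
  exists C : R, 0 < C /\
    forall (u : R -> torus R -> R * R) (kappa : R) (x : torus R) (t : R)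
      (d : measure_display) (Om : measurableType d) (P : probability Om R)
      (F : R -> set (set Om)) (w : R -> {RV P >-> (R * R)%type})
      (X : R -> {RV P >-> torus R}),
    Linf_holder alpha u ->
    0 < kappa -> kappa < 1 ->
    0 <= t -> t <= 1 ->
    is_filtration F ->
    is_brownian_motion F w ->
    is_sde_solution u kappa x F w X ->
    (torus_variance (X t) <=
      (C * (kappa * t +
            (fine (Linf_holder_norm alpha u) * t) `^ (2 / (1 - alpha))))%:E)%E.
Proof.
pose C4 : R := 4 `^ (2 / (1 - alpha)).
have C40 : 0 <= C4 by exact: powR_ge0.
exists (3 * C4 + 24 * 64); split.
  by apply: ltr_wpDl; [rewrite mulr_ge0|rewrite mulr_gt0].
move=> u kappa x t d Om P F w X uL k0 _ t0 t1 _ wB XS.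
pose M := fine (Linf_holder_norm alpha u).
have M0 : 0 <= M by rewrite fine_ge0// Linf_holder_norm_ge0.
pose c2 : R := C4 * (M * t) `^ (2 / (1 - alpha)).
have c20 : 0 <= c2 by rewrite mulr_ge0 ?powR_ge0.
have c2E : (4 * M * t) `^ (1 - alpha)^-1 ^+ 2 = c2.
  rewrite -powR_mulrn ?powR_ge0// -powRrM /c2 /C4 -powRM ?mulr_ge0//.
  by rewrite mulrA [_^-1 * _]mulrC.
pose G := mean_cost P w t.
have G0 om : (0 <= G om)%E by exact: mean_cost_ge0.
have mG : measurable_fun setT G by exact: measurable_mean_cost.
have EG : (\int[P]_om G om <= (32 * t)%:E)%E.
  exact: (expectation_mean_cost P F w wB).
pose good om := trajectory u kappa x (fun s => w s om) (fun s => X s om).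
have aegood : {ae P, forall om, good om}.
  have := sde_integrable XS; have := sde_equation XS.
  have := brownian_continuous wB.
  by apply: filterS3 => om ? ? [? ?]; split.
(* [om'] is the outcome whose trajectory serves as the centre. *)
have close om om' : good om -> good om' ->
    ((tdist (X t om) (X t om') ^+ 2)%:E <=
     (3 * c2)%:E + (24 * kappa)%:E * (G om + G om'))%E.
  move=> g g'; have [cw _ _ _] := g; have [cw' _ _ _] := g'.
  rewrite /G !mean_cost_noise//.
  have := trajectories_close alpha u kappa x alpha_gt0 alpha_lt1 uL (ltW k0)
    _ _ _ _ t g g' t0 t1.
  rewrite c2E -lee_fin [leRHS]EFinD [X in (_ + X)%E]EFinM.
  by rewrite [X in (_ * X)%E]EFinD.
pose V := torus_variance (X t).
have mdist a : measurable_fun setT (fun y : torus R => (tdist y a ^+ 2)%:E).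
  by apply/measurable_EFinP; apply: measurable_funX; exact: measurable_tdist.
have dist0 (a y : torus R) : (0 <= (tdist y a ^+ 2)%:E)%E.
  by rewrite lee_fin sqr_ge0.
have V0 : (0 <= V)%E.
  by apply: le_ereal_inf_tmp => _ [a _ <-]; exact: integral_ge0.
have k240 : (0 <= (24 * kappa)%:E)%E by rewrite lee_fin mulr_ge0// ltW.
have c30 : (0 <= (3 * c2)%:E)%E by rewrite lee_fin mulr_ge0.
have intc (k : \bar R) : (\int[P]_om k = k)%E.
  rewrite -[RHS]mule1 -(@probability_setT _ _ _ P).
  exact: (integral_cst P measurableT).
have affine (e : \bar R) : (0 <= e)%E ->
    (\int[P]_om ((3 * c2)%:E + (24 * kappa)%:E * (G om + e)) <=
     (3 * c2)%:E + (24 * kappa)%:E * ((32 * t)%:E + e))%E.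
  move=> e0; rewrite ge0_integralD//; last 2 first.
  - by move=> om _; rewrite mule_ge0// adde_ge0.
  - by apply: emeasurable_funM => //; exact: emeasurable_funD.
  rewrite intc leeD2l//.
  rewrite ge0_integralZl//; last 2 first.
  - exact: emeasurable_funD.
  - by move=> om _; rewrite adde_ge0.
  rewrite lee_wpmul2l// ge0_integralD// intc.
  by rewrite leeD2r.
have VG om' : good om' ->
    (V <= (3 * c2)%:E + (24 * kappa)%:E * ((32 * t)%:E + G om'))%E.
  move=> g'; apply: le_trans (affine _ (G0 om')).
  apply: (@le_trans _ _ (\int[P]_om (tdist (X t om) (X t om') ^+ 2)%:E)%E).
    rewrite -(ge0_integral_distribution (X t) (mdist _) (dist0 (X t om'))).
    by apply: ereal_inf_lbound; exists (X t om').
  apply: ae_ge0_le_integral => //.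
  - exact: (measurableT_comp (mdist _)).
  - by move=> om _; rewrite adde_ge0// mule_ge0// adde_ge0.
  - apply: emeasurable_funD => //; apply: emeasurable_funM => //.
    exact: emeasurable_funD.
  - by apply: filterS aegood => om g _; exact: close.
(* Averaging over the outcome of the centre; [V] is a constant. *)
have VE : (V <= (3 * c2)%:E + (24 * kappa)%:E * ((32 * t)%:E + (32 * t)%:E))%E.
  have t32 : (0 <= (32 * t)%:E)%E by rewrite lee_fin mulr_ge0.
  apply: le_trans (affine _ t32).
  have -> : V = (\int[P]_om V)%E by rewrite intc.
  apply: ae_ge0_le_integral => //.
  - by move=> om _; rewrite adde_ge0// mule_ge0// adde_ge0.
  - apply: emeasurable_funD => //; apply: emeasurable_funM => //.
    exact: emeasurable_funD.
  - apply: filterS aegood => om g _.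
    by rewrite [(G om + _)%E]addeC; exact: VG.
have {}VE : (V <= (3 * c2 + 24 * kappa * (32 * t + 32 * t))%:E)%E.
  by rewrite EFinD [X in (_ + X)%E]EFinM [X in (_ * X)%E]EFinD.
apply: (le_trans VE); rewrite lee_fin -/M.
have := powR_ge0 (M * t) (2 / (1 - alpha)).
rewrite /c2; set p := (M * t) `^ _ => p0.
have kt0 : 0 <= kappa * t by rewrite mulr_ge0// ltW.
have : 0 <= C4 * (kappa * t) by rewrite mulr_ge0.
lra.
Qed.
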